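(* Let $R$ be an associative ring with unit and let $\mathbb F$ be a right $\mathcal R$-module such that, for every $R$-algebra $S$, the natural morphism $$\mathbb F(\pi_S)_{|\overline{\mathbb F}(S)}\colon \overline{\mathbb F}(S)\to\mathbb F(S)$$ is an isomorphism. Let $\mathbb F'$ be another right $\mathcal R$-module. Then there is a natural isomorphism $$\mathrm{Hom}_{\mathcal R}(\mathbb F,\mathbb F')\xrightarrow{\ \sim\ }\mathrm{Hom}_{\mathcal R}(\overline{\mathbb F},\overline{\mathbb F'}),\qquad \phi\mapsto\overline\phi,$$ where $\mathrm{Hom}_{\mathcal R}(\mathbb F,\mathbb F')$ is the set of morphisms of right $\mathcal R$-modules, $\mathrm{Hom}_{\mathcal R}(\overline{\mathbb F},\overline{\mathbb F'})$ is the set of morphisms of functors of groups from $\overline{\mathbb F}$ to $\overline{\mathbb F'}$ (functors from $R$-modules to abelian groups), and $\overline\phi_M(f):=\phi_{R\langle M\rangle}(f)$ for every $R$-module $M$ and $f\in\overline{\mathbb F}(M)\subseteq\mathbb F(R\langle M\rangle)$.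
   Context: ''$R$-module'' means left $R$-module. An $R$-algebra is an associative unital ring $S$ together with a unital ring homomorphism $R\to S$ (the image is not assumed to be central); morphisms are ring homomorphisms compatible with the maps from $R$. A right $\mathcal R$-module is a covariant functor $\mathbb F$ from $R$-algebras to abelian groups together with a right $S$-module structure on $\mathbb F(S)$ for every $R$-algebra $S$, functorial in $S$ (i.e. the actions form a morphism of functors of sets, where $\mathcal R(S):=S$). A morphism of right $\mathcal R$-modules is a morphism of functors that is right $S$-linear for every $S$. For an $R$-module $M$, $R\langle M\rangle:=T^\cdot_R(M\otimes_{\mathbb Z}R)=(T^\cdot_{\mathbb Z}M)\otimes_{\mathbb Z}R=\bigoplus_{n\ge 0}M^{\otimes_{\mathbb Z}n}\otimes_{\mathbb Z}R$ is the tensor $R$-algebra of the $R$-bimodule $M\otimes_{\mathbb Z}R$. Writing $m_1\cdots m_n\cdot r$ for $m_1\otimes\cdots\otimes m_n\otimes r$, its product is $(m_1\cdots m_n\cdot r)(m_1'\cdots m_{n'}'\cdot r')=m_1\cdots m_n\cdot(rm_1')\cdot m_2'\cdots m'_{n'}\cdot r'$. An element $m\in M$ is identified with $m\otimes 1\in R\langle M\rangle$; an $R$-linear map from $M$ to an $R$-algebra $S$ extends uniquely to an $R$-algebra morphism $R\langle M\rangle\to S$. $M\oplus Rx$ denotes $M\oplus R$, with $x$ the generator of the second summand. Let $h_x\colon R\langle M\oplus Rx\rangle\to R\langle M\oplus Rx\rangle$ be the $R$-algebra morphism with $h_x(m)=m\cdot x$ for $m\in M$ and $h_x(x)=x$.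 The extension of a right $\mathcal R$-module $\mathbb F$ is the functor $\overline{\mathbb F}$ from $R$-modules to abelian groups given by $$\overline{\mathbb F}(M):=\mathrm{Ker}\big[\mathbb F(R\langle M\rangle)\to\mathbb F(R\langle M\oplus Rx\rangle),\ f\mapsto\mathbb F(h_x)(f)-f\cdot x\big],$$ where on the right $f$ also denotes its image in $\mathbb F(R\langle M\oplus Rx\rangle)$ under the map induced by $M\subseteq M\oplus Rx$. For an $R$-linear $w\colon M\to M'$, $\overline{\mathbb F}(w)$ is the restriction of $\mathbb F(\tilde w)$, where $\tilde w\colon R\langle M\rangle\to R\langle M'\rangle$ is the $R$-algebra morphism with $\tilde w(m)=w(m)$. For an $R$-algebra $S$ (regarded as a left $R$-module), $\pi_S\colon R\langle S\rangle\to S$ is the morphism of $R$-algebras with $\pi_S(s)=s$ for all $s\in S$. *)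

(* Defs.v *)
From HB Require Import structures.
From mathcomp Require Import all_boot all_algebra.
From mathcomp Require Import boolp.
From mathcomp Require Import ring_quotient generic_quotient.
From mathcomp.multinomials Require Import freeg.

Set Implicit Arguments.
Unset Strict Implicit.
Unset Printing Implicit Defensive.

Import GRing.Theory.
Local Open Scope ring_scope.
Local Open Scope quotient_scope.

(* Rings are pzRingType: the zero ring is allowed, both as R and as an
   R-algebra.  This rules out lalgType, which extends nzRingType. *)

Record rAlg (R : pzRingType) := RAlg {
  ralg_ring :> pzRingType;
  ralg_map : {rmorphism R -> ralg_ring}
}.

Record rAlgHom (R : pzRingType) (S T : rAlg R) := RAlgHom {
  ralg_fun :> {rmorphism S -> T};
  ralg_funK : forall r : R, ralg_fun (ralg_map S r) = ralg_map T r
}.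

Section RAlgHoms.
Variable R : pzRingType.
Implicit Types S T U : rAlg R.

Definition idAlg S : rAlgHom S S :=
  @RAlgHom R S S (idfun : {rmorphism S -> S}) (fun r => erefl).

Lemma compAlg_subproof S T U (g : rAlgHom T U) (f : rAlgHom S T) (r : R) :
  (g \o f : {rmorphism S -> U}) (ralg_map S r) = ralg_map U r.
Proof. by rewrite /= !ralg_funK. Qed.

Definition compAlg S T U (g : rAlgHom T U) (f : rAlgHom S T) : rAlgHom S U :=
  RAlgHom (compAlg_subproof g f).

Lemma rmorphism_ext (A B : pzRingType) (f g : {rmorphism A -> B}) :
  f =1 g -> f = g.
Proof.
case: f => f [[cf0] [cf1]]; case: g => g [[cg0] [cg1]] /= efg.
have {}efg : f = g by exact: funext.
subst g; congr GRing.RMorphism.Pack; congr GRing.RMorphism.Class.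
  by congr Algebra.isNmodMorphism.Axioms_; exact: Prop_irrelevance.
by congr GRing.isMonoidMorphism.Axioms_; exact: Prop_irrelevance.
Qed.

Lemma rAlgHom_ext S T (f g : rAlgHom S T) : f =1 g -> f = g.
Proof.
case: f => f cf; case: g => g cg /= efg.
have {}efg : f = g by exact: rmorphism_ext.
by subst g; congr RAlgHom; exact: Prop_irrelevance.
Qed.

End RAlgHoms.

(* S as a left R-module. *)
Definition ralg_mod (R : pzRingType) (S : rAlg R) : Type := S.

Section RAlgMod.
Variables (R : pzRingType) (S : rAlg R).

HB.instance Definition _ := GRing.Zmodule.copy (ralg_mod S) (ralg_ring S).

Definition ralg_scale (r : R) (s : ralg_mod S) : ralg_mod S :=
  ralg_map S r * (s : S).

Fact ralg_scaleA a b v :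
  ralg_scale a (ralg_scale b v) = ralg_scale (a * b) v.
Proof. by rewrite /ralg_scale rmorphM mulrA. Qed.
Fact ralg_scale1 : left_id 1 ralg_scale.
Proof. by move=> v; rewrite /ralg_scale rmorph1 mul1r. Qed.
Fact ralg_scaleDr : right_distributive ralg_scale +%R.
Proof. by move=> a u v; exact: mulrDr. Qed.
Fact ralg_scaleDl v : {morph ralg_scale^~ v : a b / a + b}.
Proof. by move=> a b; rewrite /ralg_scale rmorphD; exact: mulrDl. Qed.

HB.instance Definition _ := GRing.Zmodule_isLmodule.Build R (ralg_mod S)
  ralg_scaleA ralg_scale1 ralg_scaleDr ralg_scaleDl.

Lemma ralg_modZ (r : R) (s : ralg_mod S) :
  r *: s = ralg_map S r * (s : S) :> S.
Proof. by []. Qed.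

End RAlgMod.

(* The underlying group of R<M> is the direct sum over n of
   M^{(x) n} (x) R (tensor products over Z), presented as the free abelian
   group on all the words (m_1, ..., m_n; r), n >= 0, modulo additivity in
   each of the n + 1 entries of a word. *)
Section TensorAlgebra.
Variables (R : pzRingType) (M : lmodType R).

Definition tword : Type := (seq M * R)%type.
HB.instance Definition _ := Choice.on tword.

Local Notation FW := {freeg tword / int}.

Definition fgen (w : tword) : FW := << w >>.

Inductive tnull : FW -> Prop :=
| Tnull_mod s m m' t r :
    tnull (fgen (s ++ (m + m') :: t, r)
             - (fgen (s ++ m :: t, r) + fgen (s ++ m' :: t, r)))
| Tnull_coef s r r' :
    tnull (fgen (s, r + r') - (fgen (s, r) + fgen (s, r')))
| Tnull_0 : tnull 0
| Tnull_sub u v : tnull u -> tnull v -> tnull (u - v).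

Definition tnullb : {pred FW} := fun u => `[< tnull u >].

Lemma tnullb_zmod : zmod_closed tnullb.
Proof.
split=> [|u v /asboolP nu /asboolP nv]; apply/asboolP; first exact: Tnull_0.
exact: Tnull_sub.
Qed.
HB.instance Definition _ := GRing.isZmodClosed.Build FW tnullb tnullb_zmod.

Definition tens : Type := Quotient.quot tnullb.
HB.instance Definition _ := GRing.Zmodule.copy tens (Quotient.quot tnullb).

(* m_1 ... m_n . r *)
Definition tmon (w : tword) : tens := \pi_(Quotient.quot tnullb) (fgen w).

Lemma tens_pi_eq (u v : FW) :
  (\pi_(Quotient.quot tnullb) u = \pi_(Quotient.quot tnullb) v) <->
  tnull (u - v).
Proof.
by split=> [/eqP|h]; [rewrite -Quotient.idealrBE => /asboolP
                     |apply/eqP; rewrite -Quotient.idealrBE; apply/asboolP].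
Qed.

Lemma tmon_addm s m m' t r :
  tmon (s ++ (m + m') :: t, r) = tmon (s ++ m :: t, r) + tmon (s ++ m' :: t, r).
Proof. by rewrite /tmon -raddfD; apply/tens_pi_eq; exact: Tnull_mod. Qed.

Lemma tmon_addr s r r' : tmon (s, r + r') = tmon (s, r) + tmon (s, r').
Proof. by rewrite /tmon -raddfD; apply/tens_pi_eq; exact: Tnull_coef. Qed.

Lemma tens_ind (P : tens -> Prop) :
    P 0 -> (forall w, P (tmon w)) -> (forall u v, P u -> P v -> P (u - v)) ->
  forall u, P u.
Proof.
move=> P0 Pw PB u; rewrite -[u]reprK.
have PN x : P x -> P (- x) by rewrite -sub0r; exact: PB.
have PD x y : P x -> P y -> P (x + y).
  by move=> Px Py; rewrite -[y]opprK; apply: PB => //; exact: PN.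
rewrite -[repr u]freeg_sumE raddf_sum.
elim/big_ind: _ => // k _.
rewrite -[coeff _ _]intz -freegU_mulz raddfMz.
have Pn n : P (tmon k *+ n) by elim: n => [|n IH]; rewrite ?mulr0n ?mulrS //; exact: PD.
case: (coeff _ _) => n; first exact: Pn.
by rewrite NegzE mulrNz; apply: PN; exact: Pn.
Qed.

Section Lift.
Variables (A : zmodType) (h : tword -> A).

Definition multiadditive :=
  (forall s m m' t r,
     h (s ++ (m + m') :: t, r) = h (s ++ m :: t, r) + h (s ++ m' :: t, r)) /\
  (forall s r r', h (s, r + r') = h (s, r) + h (s, r')).

Definition flift (u : FW) : A := fglift (h : tword -> zmodule A) u.

Lemma fliftB u v : flift (u - v) = flift u - flift v.
Proof. exact: (lift_is_additive (h : tword -> zmodule A)). Qed.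

Lemma flift_gen w : flift (fgen w) = h w.
Proof. by rewrite /flift /fgen liftU scale1r. Qed.

Lemma flift0 : flift 0 = 0.
Proof. by have := fliftB 0 0; rewrite !subrr. Qed.

Lemma fliftD u v : flift (u + v) = flift u + flift v.
Proof. by have := fliftB (u + v) v; rewrite addrK => ->; rewrite subrK. Qed.

Definition tlift_fun (u : tens) : A :=
  flift (repr (u : Quotient.quot tnullb)).

Hypothesis hM : multiadditive.

Lemma flift_null u : tnull u -> flift u = 0.
Proof.
case: hM => h1 h2; elim=> [s m m' t r|s r r'||{}u v _ IHu _ IHv].
- by rewrite fliftB fliftD !flift_gen h1 subrr.
- by rewrite fliftB fliftD !flift_gen h2 subrr.
- exact: flift0.
- by rewrite fliftB IHu IHv subr0.
Qed.

Lemma tlift_pi u : tlift_fun (\pi_(Quotient.quot tnullb) u) = flift u.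
Proof.
apply/eqP; rewrite -subr_eq0 -fliftB; apply/eqP/flift_null/tens_pi_eq.
by rewrite reprK.
Qed.

Lemma tlift_tmon w : tlift_fun (tmon w) = h w.
Proof. by rewrite /tmon tlift_pi flift_gen. Qed.

Lemma tliftB u v : tlift_fun (u - v) = tlift_fun u - tlift_fun v.
Proof.
by rewrite -[u]reprK -[v]reprK -raddfB !tlift_pi fliftB.
Qed.

End Lift.

(* (m_1...m_n . r)(m'_1...m'_n' . r') = m_1...m_n (r m'_1) m'_2...m'_n' . r' *)
Definition wmul (w w' : tword) : tword :=
  match w'.1 with
  | [::] => (w.1, w.2 * w'.2)
  | m :: t => (w.1 ++ (w.2 *: m) :: t, w'.2)
  end.

Definition tmul (u v : tens) : tens :=
  tlift_fun (fun w => tlift_fun (fun w' => tmon (wmul w w')) v) u.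

Lemma wmulA : associative wmul.
Proof.
move=> [a r] [[|b bs] r'] [[|c cs] r'']; rewrite /wmul //= ?mulrA ?scalerA //.
by rewrite -catA.
Qed.

Lemma wmul_multiadd w : multiadditive (fun w' => tmon (wmul w w')).
Proof.
case: w => a r; split=> [[|x s] m m' t r'|[|x s] r' r'']; rewrite /wmul /=.
- by rewrite scalerDr tmon_addm.
- by have := tmon_addm (a ++ r *: x :: s) m m' t r'; rewrite -!catA.
- by rewrite mulrDr tmon_addr.
- exact: tmon_addr.
Qed.

Lemma tmul_multiadd v :
  multiadditive (fun w => tlift_fun (fun w' => tmon (wmul w w')) v).
Proof.
have lB := fun w => tliftB (wmul_multiadd w).
elim/tens_ind: v => [|[[|x b] q]|u v [IH1 IH2] [IH3 IH4]].
- by split=> *; rewrite -(subrr (0 : tens)) !lB !subrr addr0.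
- split=> *; rewrite !(tlift_tmon (wmul_multiadd _)) /wmul /=.
    exact: tmon_addm.
  by rewrite mulrDl tmon_addr.
- split=> *; rewrite !(tlift_tmon (wmul_multiadd _)) /wmul /=.
    by rewrite -!catA tmon_addm.
  by rewrite scalerDl tmon_addm.
- by split=> *; rewrite !lB ?(IH1, IH3, IH2, IH4) opprD addrACA.
Qed.

Lemma tmulBr u : {morph tmul u : v v' / v - v'}.
Proof.
move=> v v'; elim/tens_ind: u => [|w|u u' IH IH']; rewrite /tmul.
- have l0 x : tlift_fun (fun w => tlift_fun (fun w' => tmon (wmul w w')) x) 0 = 0.
    by have := tliftB (tmul_multiadd x) 0 0; rewrite !subrr.
  by rewrite !l0 subrr.
- by rewrite !(tlift_tmon (tmul_multiadd _)) (tliftB (wmul_multiadd w)).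
- by rewrite !(tliftB (tmul_multiadd _)) -!/(tmul _ _) IH IH' !opprD !opprK addrACA.
Qed.

Lemma tmulBl v : {morph tmul^~ v : u u' / u - u'}.
Proof. by move=> u u'; rewrite /= /tmul (tliftB (tmul_multiadd v)). Qed.

Lemma tmul0r v : tmul 0 v = 0.
Proof. by have := tmulBl v 0 0; rewrite /= !subrr. Qed.

Lemma tmulr0 u : tmul u 0 = 0.
Proof. by have := tmulBr u 0 0; rewrite /= !subrr. Qed.

Lemma tmulDl : left_distributive tmul +%R.
Proof.
by move=> u u' v; have /= := tmulBl v (u + u') u'; rewrite addrK => ->; rewrite subrK.
Qed.

Lemma tmulDr : right_distributive tmul +%R.
Proof.
by move=> u v v'; have /= := tmulBr u (v + v') v'; rewrite addrK => ->; rewrite subrK.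
Qed.

Lemma tmul_tmon w w' : tmul (tmon w) (tmon w') = tmon (wmul w w').
Proof.
by rewrite /tmul (tlift_tmon (tmul_multiadd _)) (tlift_tmon (wmul_multiadd w)).
Qed.

Lemma tmulA : associative tmul.
Proof.
move=> u v x; elim/tens_ind: u => [|w|u u' IH IH']; first by rewrite !tmul0r.
  elim/tens_ind: v => [|w'|v v' IH IH']; first by rewrite tmul0r tmulr0 tmul0r.
    elim/tens_ind: x => [|w''|x x' IH IH']; first by rewrite !tmulr0.
      by rewrite !tmul_tmon wmulA.
    by rewrite !tmulBr IH IH'.
  by rewrite tmulBr !tmulBl tmulBr IH IH'.
by rewrite !tmulBl IH IH'.
Qed.

Definition tone : tens := tmon ([::], 1).

Lemma tmul1r : left_id tone tmul.
Proof.
move=> u; elim/tens_ind: u => [|[[|m t] r]|u u' IH IH']; first exact: tmulr0.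
- by rewrite tmul_tmon /wmul /= mul1r.
- by rewrite tmul_tmon /wmul /= scale1r.
- by rewrite tmulBr IH IH'.
Qed.

Lemma tmulr1 : right_id tone tmul.
Proof.
move=> u; elim/tens_ind: u => [|[s r]|u u' IH IH']; first exact: tmul0r.
- by rewrite tmul_tmon /wmul /= mulr1.
- by rewrite tmulBl IH IH'.
Qed.

HB.instance Definition _ := GRing.Zmodule_isPzRing.Build tens
  tmulA tmul1r tmulr1 tmulDl tmulDr.

Definition tscal (r : R) : tens := tmon ([::], r).

Lemma tscal_zmod : zmod_morphism tscal.
Proof.
move=> r r'; apply/eqP; rewrite eq_sym subr_eq; apply/eqP.
by rewrite -tmon_addr subrK.
Qed.
HB.instance Definition _ := GRing.isZmodMorphism.Build R tens tscal tscal_zmod.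

Lemma tscal_monoid : monoid_morphism tscal.
Proof. by split=> // r r'; rewrite [RHS]tmul_tmon. Qed.
HB.instance Definition _ := GRing.isMonoidMorphism.Build R tens tscal tscal_monoid.

(* R<M> *)
Definition tensAlg : rAlg R := @RAlg R tens tscal.

(* m |-> m . 1 *)
Definition tincl_fun (m : M) : ralg_mod tensAlg := tmon ([:: m], 1).

Lemma tincl_zmod : zmod_morphism tincl_fun.
Proof.
move=> m m'; apply/eqP; rewrite eq_sym subr_eq; apply/eqP.
by have := tmon_addm [::] (m - m') m' [::] 1; rewrite subrK.
Qed.
HB.instance Definition _ :=
  GRing.isZmodMorphism.Build M (ralg_mod tensAlg) tincl_fun tincl_zmod.

Lemma tincl_scal : scalable tincl_fun.
Proof.
by move=> r m; rewrite ralg_modZ /= [RHS]tmul_tmon.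
Qed.
HB.instance Definition _ :=
  GRing.isScalable.Build R M (ralg_mod tensAlg) *:%R tincl_fun tincl_scal.

Definition tincl : {linear M -> ralg_mod tensAlg} := tincl_fun.

(* The R-algebra morphism R<M> -> S extending a linear map w : M -> S. *)
Section Extend.
Variables (S : rAlg R) (w : {linear M -> ralg_mod S}).

Definition weval (x : tword) : S :=
  (\prod_(m <- x.1) (w m : S)) * ralg_map S x.2.

Lemma weval_multiadd : multiadditive weval.
Proof.
split=> [s m m' t r|s r r']; rewrite /weval /=; last by rewrite rmorphD mulrDr.
by rewrite !big_cat !big_cons /= raddfD /= mulrDl mulrDr mulrDl.
Qed.

Definition textend_fun (u : tens) : S := tlift_fun weval u.

Lemma textend_tmon x : textend_fun (tmon x) = weval x.
Proof. exact: tlift_tmon weval_multiadd x. Qed.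

Lemma textend_zmod : zmod_morphism textend_fun.
Proof. exact: tliftB weval_multiadd. Qed.
HB.instance Definition _ :=
  GRing.isZmodMorphism.Build tens S textend_fun textend_zmod.

Lemma weval_mul x y : weval (wmul x y) = weval x * weval y.
Proof.
case: x y => a r [[|m t] r']; rewrite /weval /wmul /=.
  by rewrite big_nil mul1r rmorphM mulrA.
rewrite big_cat !big_cons /= linearZ /= [X in _ * (X * _) * _]ralg_modZ.
by rewrite !mulrA.
Qed.

Lemma textend_monoid : monoid_morphism textend_fun.
Proof.
split=> [|u v]; first by rewrite textend_tmon /weval big_nil mul1r rmorph1.
elim/tens_ind: u => [|x|u u' IH IH']; first by rewrite mul0r raddf0 mul0r.
  elim/tens_ind: v => [|y|v v' IH IH']; first by rewrite mulr0 raddf0 mulr0.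
    by rewrite [tmon _ * _]tmul_tmon !textend_tmon weval_mul.
  by rewrite mulrBr !raddfB /= IH IH' mulrBr.
by rewrite mulrBl !raddfB /= IH IH' mulrBl.
Qed.
HB.instance Definition _ :=
  GRing.isMonoidMorphism.Build tens S textend_fun textend_monoid.

Lemma textend_comm (r : R) : textend_fun (ralg_map tensAlg r) = ralg_map S r.
Proof. by rewrite textend_tmon /weval big_nil mul1r. Qed.

Definition textend : rAlgHom tensAlg S :=
  @RAlgHom R tensAlg S textend_fun textend_comm.

Lemma textend_incl (m : M) : textend (tincl m) = w m.
Proof.
by rewrite [LHS]textend_tmon /weval big_seq1 rmorph1 mulr1.
Qed.

End Extend.

Lemma tmon_cons (m : M) t r : tmon (m :: t, r) = (tincl m : tens) * tmon (t, r).
Proof.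
by rewrite [RHS]tmul_tmon /wmul; case: t => [|m' t] /=; rewrite (mul1r, scale1r).
Qed.

Lemma tensAlg_ext (S : rAlg R) (f g : rAlgHom tensAlg S) :
  (forall m, f (tincl m) = g (tincl m)) -> f = g.
Proof.
move=> efg; apply: rAlgHom_ext => u.
elim/tens_ind: u => [|[s r]|u v IHu IHv]; first by rewrite !rmorph0.
  elim: s => [|m s IH]; first exact: (etrans (ralg_funK f r) (esym (ralg_funK g r))).
  by rewrite tmon_cons !rmorphM IH; congr (_ * _); exact: efg.
by rewrite !rmorphB IHu IHv.
Qed.

End TensorAlgebra.

(* A right module over the functor S |-> S; a right S-module is a left module
   over the converse ring S^c. *)
Record rightMod (R : pzRingType) := RightMod {
  rmod_obj :> forall S : rAlg R, lmodType (S : pzRingType)^c;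
  rmod_map : forall S T : rAlg R,
    rAlgHom S T -> {additive rmod_obj S -> rmod_obj T};
  rmod_map_id : forall (S : rAlg R) (f : rmod_obj S),
    rmod_map (idAlg S) f = f;
  rmod_map_comp : forall (S T U : rAlg R) (g : rAlgHom T U) (h : rAlgHom S T)
      (f : rmod_obj S),
    rmod_map (compAlg g h) f = rmod_map g (rmod_map h f);
  rmod_map_act : forall (S T : rAlg R) (h : rAlgHom S T) (s : S)
      (f : rmod_obj S),
    rmod_map h ((s : S^c) *: f) = (h s : T^c) *: rmod_map h f
}.

Definition ract (R : pzRingType) (F : rightMod R) (S : rAlg R) (f : F S) (s : S)
  : F S := (s : S^c) *: f.

Record rightModHom (R : pzRingType) (F F' : rightMod R) := RightModHom {
  rmodh :> forall S : rAlg R, {linear F S -> F' S};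
  rmodh_nat : forall (S T : rAlg R) (h : rAlgHom S T) (f : F S),
    rmodh T (rmod_map F h f) = rmod_map F' h (rmodh S f)
}.

Record modFun (R : pzRingType) := ModFun {
  mfun_obj :> lmodType R -> zmodType;
  mfun_map : forall M N : lmodType R,
    {linear M -> N} -> {additive mfun_obj M -> mfun_obj N};
  mfun_map_id : forall (M : lmodType R) (f : mfun_obj M),
    mfun_map (idfun : {linear M -> M}) f = f;
  mfun_map_comp : forall (M N P : lmodType R) (v : {linear N -> P})
      (w : {linear M -> N}) (f : mfun_obj M),
    mfun_map (v \o w : {linear M -> P}) f = mfun_map v (mfun_map w f)
}.

Record modFunHom (R : pzRingType) (G G' : modFun R) := ModFunHom {
  mfunh :> forall M : lmodType R, {additive G M -> G' M};
  mfunh_nat : forall (M N : lmodType R) (w : {linear M -> N}) (f : G M),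
    mfunh N (mfun_map G w f) = mfun_map G' w (mfunh M f)
}.

Section HomOperations.
Variable R : pzRingType.

Lemma rmodh_comp_nat (F F' F'' : rightMod R) (psi : rightModHom F' F'')
    (phi : rightModHom F F') (S T : rAlg R) (h : rAlgHom S T) (f : F S) :
  (psi T \o phi T : {linear F T -> F'' T}) (rmod_map F h f) =
  rmod_map F'' h ((psi S \o phi S : {linear F S -> F'' S}) f).
Proof. by rewrite /= !rmodh_nat. Qed.

Definition rmodh_comp (F F' F'' : rightMod R) (psi : rightModHom F' F'')
  (phi : rightModHom F F') : rightModHom F F'' :=
  RightModHom (rmodh_comp_nat psi phi).

Lemma rmodh_add_nat (F F' : rightMod R) (phi psi : rightModHom F F')
    (S T : rAlg R) (h : rAlgHom S T) (f : F S) :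
  (phi T \+ psi T : {linear F T -> F' T}) (rmod_map F h f) =
  rmod_map F' h ((phi S \+ psi S : {linear F S -> F' S}) f).
Proof. by rewrite /= !rmodh_nat raddfD. Qed.

Definition rmodh_add (F F' : rightMod R) (phi psi : rightModHom F F') :
  rightModHom F F' := RightModHom (rmodh_add_nat phi psi).

Lemma mfunh_comp_nat (G G' G'' : modFun R) (psi : modFunHom G' G'')
    (phi : modFunHom G G') (M N : lmodType R) (w : {linear M -> N}) (f : G M) :
  (psi N \o phi N : {additive G N -> G'' N}) (mfun_map G w f) =
  mfun_map G'' w ((psi M \o phi M : {additive G M -> G'' M}) f).
Proof. by rewrite /= !mfunh_nat. Qed.

Definition mfunh_comp (G G' G'' : modFun R) (psi : modFunHom G' G'')
  (phi : modFunHom G G') : modFunHom G G'' :=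
  ModFunHom (mfunh_comp_nat psi phi).

Lemma mfunh_add_nat (G G' : modFun R) (phi psi : modFunHom G G')
    (M N : lmodType R) (w : {linear M -> N}) (f : G M) :
  (phi N \+ psi N : {additive G N -> G' N}) (mfun_map G w f) =
  mfun_map G' w ((phi M \+ psi M : {additive G M -> G' M}) f).
Proof. by rewrite /= !mfunh_nat raddfD. Qed.

Definition mfunh_add (G G' : modFun R) (phi psi : modFunHom G G') :
  modFunHom G G' := ModFunHom (mfunh_add_nat phi psi).

Lemma additive_ext (A B : zmodType) (f g : {additive A -> B}) :
  f =1 g -> f = g.
Proof.
case: f => f [[cf]]; case: g => g [[cg]] /= efg.
have {}efg : f = g by exact: funext.
subst g; congr Algebra.Additive.Pack; congr Algebra.Additive.Class.
by congr Algebra.isNmodMorphism.Axioms_; exact: Prop_irrelevance.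
Qed.

Lemma linear_ext (A : pzRingType) (U V : lmodType A) (f g : {linear U -> V}) :
  f =1 g -> f = g.
Proof.
case: f => f [[cf] [sf]]; case: g => g [[cg] [sg]] /= efg.
have {}efg : f = g by exact: funext.
subst g; congr GRing.Linear.Pack; congr GRing.Linear.Class.
  by congr Algebra.isNmodMorphism.Axioms_; exact: Prop_irrelevance.
by congr GRing.isScalable.Axioms_; exact: Prop_irrelevance.
Qed.

Lemma rightModHom_ext (F F' : rightMod R) (phi psi : rightModHom F F') :
  (forall S f, phi S f = psi S f) -> phi = psi.
Proof.
case: phi => phi cphi; case: psi => psi cpsi /= e.
have {}e : phi = psi by apply: functional_extensionality_dep => S; exact: (linear_ext (e S)).
by subst psi; congr RightModHom; exact: Prop_irrelevance.
Qed.

Lemma modFunHom_ext (G G' : modFun R) (phi psi : modFunHom G G') :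
  (forall M f, phi M f = psi M f) -> phi = psi.
Proof.
case: phi => phi cphi; case: psi => psi cpsi /= e.
have {}e : phi = psi by apply: functional_extensionality_dep => M; exact: (additive_ext (e M)).
by subst psi; congr ModFunHom; exact: Prop_irrelevance.
Qed.

End HomOperations.

Section Maps.
Variable R : pzRingType.

(* w~ : R<M> -> R<N> *)
Definition tmap (M N : lmodType R) (w : {linear M -> N}) :
  rAlgHom (tensAlg M) (tensAlg N) :=
  textend (@tincl R N \o w : {linear M -> ralg_mod (tensAlg N)}).

Lemma tmap_incl (M N : lmodType R) (w : {linear M -> N}) (m : M) :
  tmap w (tincl M m) = tincl N (w m).
Proof. exact: textend_incl. Qed.

(* pi_S : R<S> -> S *)
Definition tpi (S : rAlg R) : rAlgHom (tensAlg (ralg_mod S)) S :=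
  textend (idfun : {linear ralg_mod S -> ralg_mod S}).

Lemma tpi_incl (S : rAlg R) (s : ralg_mod S) : tpi S (tincl _ s) = s.
Proof. exact: textend_incl. Qed.

Section AddVariable.
Variable M : lmodType R.

(* M (+) Rx *)
Definition addx : lmodType R := (M * R^o)%type.

Definition inM_fun (m : M) : addx := (m, 0).
Lemma inM_linear : linear inM_fun.
Proof. by move=> r m m'; congr (_, _); rewrite /= ?scaler0 ?addr0. Qed.
HB.instance Definition _ := GRing.isLinear.Build R M addx *:%R inM_fun inM_linear.
Definition inM : {linear M -> addx} := inM_fun.

Definition varx : tensAlg addx := tincl addx (0, 1).

Definition hx_fun (p : addx) : ralg_mod (tensAlg addx) :=
  (tincl addx (inM p.1) : tensAlg addx) * varx
    + ralg_map (tensAlg addx) p.2 * varx.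
Lemma hx_linear : linear hx_fun.
Proof.
move=> r p q; rewrite ralg_modZ /hx_fun.
have -> : tincl addx (inM (r *: p + q).1) =
    r *: tincl addx (inM p.1) + tincl addx (inM q.1) by rewrite -!linearP.
have -> : ralg_map (tensAlg addx) (r *: p + q).2 =
    ralg_map _ r * ralg_map _ (p.2 : R) + ralg_map _ (q.2 : R).
  by rewrite -rmorphM -rmorphD.
rewrite ralg_modZ; set a := tincl addx _; set b := tincl addx _.
have mD (x y z : tensAlg addx) : (x + y) * z = x * z + y * z by exact: mulrDl.
by rewrite [X in X + _ = _]mD mD addrACA -!mulrA -mulrDr.
Qed.
HB.instance Definition _ :=
  GRing.isLinear.Build R addx (ralg_mod (tensAlg addx)) *:%R hx_fun hx_linear.

(* h_x : m |-> m . x, r x |-> r x *)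
Definition hx : rAlgHom (tensAlg addx) (tensAlg addx) :=
  textend (hx_fun : {linear addx -> ralg_mod (tensAlg addx)}).

Lemma hx_incl (m : M) :
  hx (tincl addx (inM m)) = (tincl addx (inM m) : tensAlg addx) * varx.
Proof. by rewrite [LHS]textend_incl /= /hx_fun rmorph0 mul0r addr0. Qed.

Lemma hx_var : hx varx = varx.
Proof.
rewrite [LHS]textend_incl /= /hx_fun rmorph1 mul1r.
set z := tincl addx _; have -> : z = 0 by rewrite /z /= !linear0.
by rewrite [X in X + _]mul0r add0r.
Qed.
End AddVariable.
End Maps.

Section Extension.
Variable R : pzRingType.
Implicit Types (F : rightMod R) (M N P : lmodType R).

Section Kernel.
Variables (F : rightMod R) (M : lmodType R).

Definition ext_diff (f : F (tensAlg M)) : F (tensAlg (addx M)) :=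
  let f' := rmod_map F (tmap (inM M)) f in
  rmod_map F (hx M) f' - ract f' (varx M).

Lemma ext_diff_zmod : zmod_morphism ext_diff.
Proof.
by move=> f g; rewrite /ext_diff /ract !raddfB /= addrACA.
Qed.
HB.instance Definition _ :=
  GRing.isZmodMorphism.Build (F (tensAlg M)) (F (tensAlg (addx M)))
    ext_diff ext_diff_zmod.

Definition ext_ker : {pred F (tensAlg M)} := fun f => ext_diff f == 0.

Lemma ext_ker_zmod : zmod_closed ext_ker.
Proof.
split=> [|f g]; first by rewrite unfold_in raddf0.
by rewrite !unfold_in ext_diff_zmod => /eqP -> /eqP ->; rewrite subrr.
Qed.
HB.instance Definition _ :=
  GRing.isZmodClosed.Build (F (tensAlg M)) ext_ker ext_ker_zmod.

Record extension : Type := Extension {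
  ext_val :> F (tensAlg M);
  ext_valP : ext_val \in ext_ker
}.
HB.instance Definition _ := [isSub for ext_val].
HB.instance Definition _ := [Choice of extension by <:].
HB.instance Definition _ := [SubChoice_isSubZmodule of extension by <:].

Lemma ext_kerP (f : F (tensAlg M)) :
  reflect (rmod_map F (hx M) (rmod_map F (tmap (inM M)) f)
           = ract (rmod_map F (tmap (inM M)) f) (varx M))
    (f \in ext_ker).
Proof. by rewrite unfold_in subr_eq0; exact: eqP. Qed.

End Kernel.

Section Widen.
Variables (M N : lmodType R) (w : {linear M -> N}).

Definition addx_fun (p : addx M) : addx N := (w p.1, p.2).
Lemma addx_linear : linear addx_fun.
Proof. by move=> r p q; rewrite /addx_fun /= linearP. Qed.
HB.instance Definition _ :=
  GRing.isLinear.Build R (addx M) (addx N) *:%R addx_fun addx_linear.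
Definition addx_map : {linear addx M -> addx N} := addx_fun.

Lemma tmap_var : tmap addx_map (varx M) = varx N.
Proof. by rewrite [LHS]tmap_incl /= /addx_fun linear0. Qed.

Lemma tmap_inM :
  compAlg (tmap (inM N)) (tmap w) = compAlg (tmap addx_map) (tmap (inM M)).
Proof.
by apply: tensAlg_ext => m; rewrite /comp /= !tmap_incl.
Qed.

Lemma tmap_hx :
  compAlg (compAlg (hx N) (tmap (inM N))) (tmap w) =
  compAlg (tmap addx_map) (compAlg (hx M) (tmap (inM M))).
Proof.
apply: tensAlg_ext => m.
transitivity (hx N (tmap (inM N) (tmap w (tincl M m)))); first by [].
transitivity (tmap addx_map (hx M (tmap (inM M) (tincl M m)))); last by [].
rewrite !tmap_incl !hx_incl rmorphM [X in _ = _ * X]tmap_var.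
by congr (_ * _); rewrite [RHS]tmap_incl.
Qed.

Lemma ext_map_subproof (F : rightMod R) (f : extension F M) :
  rmod_map F (tmap w) (ext_val f) \in @ext_ker F N.
Proof.
apply/ext_kerP; case: f => f /= /ext_kerP ef.
rewrite -2!rmod_map_comp tmap_hx 2!rmod_map_comp ef /ract rmod_map_act tmap_var.
by rewrite -!rmod_map_comp tmap_inM.
Qed.

Definition ext_map (F : rightMod R) (f : extension F M) : extension F N :=
  Extension (ext_map_subproof f).

Lemma ext_map_zmod F : zmod_morphism (@ext_map F).
Proof. by move=> f g; apply: val_inj; rewrite /= !raddfB. Qed.
HB.instance Definition _ F :=
  GRing.isZmodMorphism.Build (extension F M) (extension F N) (@ext_map F)
    (@ext_map_zmod F).

End Widen.

Lemma tmap_id M : tmap (idfun : {linear M -> M}) = idAlg (tensAlg M).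
Proof. by apply: tensAlg_ext => m; rewrite tmap_incl. Qed.

Lemma tmap_comp M N P (v : {linear N -> P}) (w : {linear M -> N}) :
  tmap (v \o w : {linear M -> P}) = compAlg (tmap v) (tmap w).
Proof. by apply: tensAlg_ext => m; rewrite /= /comp /= !tmap_incl. Qed.

Lemma ext_map_id F M (f : extension F M) :
  ext_map (idfun : {linear M -> M}) f = f.
Proof. by apply: val_inj; rewrite /= tmap_id rmod_map_id. Qed.

Lemma ext_map_comp F M N P (v : {linear N -> P}) (w : {linear M -> N})
    (f : extension F M) :
  ext_map (v \o w : {linear M -> P}) f = ext_map v (ext_map w f).
Proof. by apply: val_inj; rewrite /= tmap_comp rmod_map_comp. Qed.

(* \overline F *)
Definition ext F : modFun R :=
  @ModFun R (fun M => extension F M)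
    (fun M N w => @ext_map M N w F) (ext_map_id (F := F)) (ext_map_comp (F := F)).

(* F(pi_S) restricted to \overline F(S). *)
Definition ext_eval F (S : rAlg R) (f : ext F (ralg_mod S)) : F S :=
  rmod_map F (tpi S) (ext_val f).

Section ExtHom.
Variables (F F' : rightMod R) (phi : rightModHom F F').

Lemma ext_hom_subproof M (f : extension F M) :
  phi (tensAlg M) (ext_val f) \in @ext_ker F' M.
Proof.
apply/ext_kerP; case: f => f /= /ext_kerP ef.
by rewrite -!rmodh_nat ef /ract linearZ.
Qed.

Definition ext_hom_fun M (f : extension F M) : extension F' M :=
  Extension (ext_hom_subproof f).

Lemma ext_hom_zmod M : zmod_morphism (@ext_hom_fun M).
Proof. by move=> f g; apply: val_inj; rewrite /= !raddfB. Qed.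
HB.instance Definition _ M :=
  GRing.isZmodMorphism.Build (extension F M) (extension F' M) (@ext_hom_fun M)
    (@ext_hom_zmod M).

Lemma ext_hom_nat M N (w : {linear M -> N}) (f : ext F M) :
  ext_hom_fun (mfun_map (ext F) w f) = mfun_map (ext F') w (ext_hom_fun f).
Proof. by apply: val_inj; rewrite /= rmodh_nat. Qed.

(* \overline phi *)
Definition ext_hom : modFunHom (ext F) (ext F') :=
  @ModFunHom R (ext F) (ext F') (fun M => @ext_hom_fun M) ext_hom_nat.

End ExtHom.
End Extension.

(* Main.v *)
Require Import Defs.
From HB Require Import structures.
From mathcomp Require Import all_boot all_algebra.
From mathcomp Require Import boolp.

(** Write [ev] for the evaluation [ext_eval], i.e. the restriction of F(pi_S) to
    Fbar(S).  Everything rests on the fact that a morphism phi of right modules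
    commutes with it:

      phi_S (ev f) = ev (phibar_S f)          ([ext_eval_hom]).

    When ev is onto for F, phibar therefore determines phi; when it is
    bijective, the formula also dictates the preimage of a given
    psi : Fbar -> F'bar, namely phi_S := ev o psi_S o ev^-1.

    That this phi is a morphism of right modules reduces to the naturality of
    psi, since both structures on F(S) are visible in the functor Fbar through
    R-linear maps: an algebra morphism S -> T is R-linear ([ext_eval_nat]), and
    so is the right multiplication by an element s of S.  The latter acts on
    Fbar(S) as s acts on F(S), and this is where the equation defining Fbar is
    used ([ext_eval_act]): substituting s for x turns h_x into the right
    multiplication by s.

    That phibar = psi is a triangle identity.  The inclusion M -> R<M> is
    R-linear, and the induced map R<M> -> R<R<M>> is a section of pi, so ev
    recovers f in Fbar(M), seen in F(R<M>), from its image in Fbar(R<M>)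
    ([ext_eval_incl]). *)

Set Implicit Arguments.
Unset Strict Implicit.
Unset Printing Implicit Defensive.

Import GRing.Theory.
Local Open Scope ring_scope.

Section LinearMaps.
Variable R : pzRingType.
Implicit Types S T : rAlg R.

Section AlgHom.
Variables (S T : rAlg R) (h : rAlgHom S T).

Definition alg_lin_fun (s : ralg_mod S) : ralg_mod T := h s.

Lemma alg_lin_linear : linear alg_lin_fun.
Proof.
move=> r s t; rewrite /alg_lin_fun !ralg_modZ.
by rewrite -(ralg_funK h) -rmorphM -rmorphD.
Qed.
HB.instance Definition _ :=
  GRing.isLinear.Build R (ralg_mod S) (ralg_mod T) *:%R alg_lin_fun
    alg_lin_linear.

Definition alg_lin : {linear ralg_mod S -> ralg_mod T} := alg_lin_fun.

Lemma tpi_nat : compAlg (tpi T) (tmap alg_lin) = compAlg h (tpi S).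
Proof.
apply: tensAlg_ext => s.
transitivity (tpi T (tmap alg_lin (tincl _ s))); first by [].
transitivity (h (tpi S (tincl _ s))); last by [].
by rewrite tmap_incl !tpi_incl.
Qed.

End AlgHom.

Section RightMultiplication.
Variables (S : rAlg R) (s : S).

Definition rmul_lin_fun (t : ralg_mod S) : ralg_mod S := (t : S) * s.

Lemma rmul_lin_linear : linear rmul_lin_fun.
Proof.
move=> r t u; rewrite /rmul_lin_fun !ralg_modZ mulrA; exact: mulrDl.
Qed.
HB.instance Definition _ :=
  GRing.isLinear.Build R (ralg_mod S) (ralg_mod S) *:%R rmul_lin_fun
    rmul_lin_linear.

Definition rmul_lin : {linear ralg_mod S -> ralg_mod S} := rmul_lin_fun.

Definition subst_lin_fun (p : addx (ralg_mod S)) : ralg_mod S :=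
  p.1 + ralg_map S p.2 * s.

Lemma subst_lin_linear : linear subst_lin_fun.
Proof.
move=> r p q; rewrite /subst_lin_fun /= rmorphD rmorphM mulrDl -mulrA scalerDr.
exact: addrACA.
Qed.
HB.instance Definition _ :=
  GRing.isLinear.Build R (addx (ralg_mod S)) (ralg_mod S) *:%R subst_lin_fun
    subst_lin_linear.

(** The substitution R<S (+) Rx> -> S of [s] for x, which is pi_S on R<S>. *)
Definition tsubst : rAlgHom (tensAlg (addx (ralg_mod S))) S :=
  textend (subst_lin_fun : {linear addx (ralg_mod S) -> ralg_mod S}).

Lemma tsubst_inM (t : ralg_mod S) : tsubst (tincl _ (inM _ t)) = t.
Proof. by rewrite [LHS]textend_incl /= /subst_lin_fun rmorph0 mul0r addr0. Qed.

Lemma tsubst_varx : tsubst (varx (ralg_mod S)) = s.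
Proof.
by rewrite [LHS]textend_incl /= /subst_lin_fun rmorph1 mul1r add0r.
Qed.

Lemma tsubst_tpi : compAlg tsubst (tmap (inM (ralg_mod S))) = tpi S.
Proof.
apply: tensAlg_ext => t.
transitivity (tsubst (tmap (inM (ralg_mod S)) (tincl _ t))); first by [].
by rewrite tmap_incl tsubst_inM tpi_incl.
Qed.

(** Both sides send a generator t of R<S> to t s; on the left, h_x first turns
    it into t x. *)
Lemma tsubst_hx :
  compAlg tsubst (compAlg (hx (ralg_mod S)) (tmap (inM (ralg_mod S)))) =
  compAlg (tpi S) (tmap rmul_lin).
Proof.
apply: tensAlg_ext => t.
transitivity (tsubst (hx _ (tmap (inM (ralg_mod S)) (tincl _ t)))); first by [].
transitivity (tpi S (tmap rmul_lin (tincl _ t))); last by [].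
by rewrite !tmap_incl hx_incl rmorphM tsubst_inM [X in _ * X]tsubst_varx tpi_incl.
Qed.

End RightMultiplication.

Lemma tpi_tmap_tincl (M : lmodType R) :
  compAlg (tpi (tensAlg M)) (tmap (tincl M)) = idAlg (tensAlg M).
Proof.
apply: tensAlg_ext => m.
transitivity (tpi (tensAlg M) (tmap (tincl M) (tincl _ m))); first by [].
by rewrite tmap_incl tpi_incl.
Qed.

End LinearMaps.

Section Evaluation.
Variable R : pzRingType.
Implicit Types (F : rightMod R) (S T : rAlg R).

Lemma ext_eval_zmod F S : zmod_morphism (@ext_eval R F S).
Proof. by move=> f g; rewrite /ext_eval /= raddfB. Qed.
HB.instance Definition _ F S :=
  GRing.isZmodMorphism.Build (ext F (ralg_mod S)) (F S) (@ext_eval R F S)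
    (@ext_eval_zmod F S).

Lemma ext_eval_nat F S T (h : rAlgHom S T) (f : ext F (ralg_mod S)) :
  ext_eval (mfun_map (ext F) (alg_lin h) f) = rmod_map F h (ext_eval f).
Proof. by rewrite /ext_eval /= -!rmod_map_comp tpi_nat. Qed.

(** Apply the substitution of [s] for x to the equation F(h_x)(f) = f.x that
    defines Fbar(S). *)
Lemma ext_eval_act F S (s : S) (f : ext F (ralg_mod S)) :
  ext_eval (mfun_map (ext F) (rmul_lin s) f) = ract (ext_eval f) s.
Proof.
rewrite /ext_eval /= -rmod_map_comp -tsubst_hx !rmod_map_comp.
rewrite (ext_kerP _ (ext_valP f)) /ract rmod_map_act tsubst_varx.
by rewrite -rmod_map_comp tsubst_tpi.
Qed.

(** Presents an element of Fbar(M), seen in F(R<M>), as a value of ev at the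
    image of that same element under an R-linear map; a natural transformation
    Fbar -> F'bar passes through that map. *)
Lemma ext_eval_incl F (M : lmodType R) (f : ext F M) :
  ext_eval (S := tensAlg M) (mfun_map (ext F) (tincl M) f) = ext_val f.
Proof. by rewrite /ext_eval /= -rmod_map_comp tpi_tmap_tincl rmod_map_id. Qed.

(** This is the naturality of [phi] along pi_S: phibar is the restriction of
    phi_{R<S>}. *)
Lemma ext_eval_hom F F' (phi : rightModHom F F') S (f : ext F (ralg_mod S)) :
  phi S (ext_eval f) = ext_eval (ext_hom phi (ralg_mod S) f).
Proof. exact: rmodh_nat. Qed.

(** A morphism psi : Fbar -> F'bar is transported to F -> F' along ev, whose
    inverse is [evI]. *)
Section Restriction.
Variables (F F' : rightMod R).
Variable evI : forall S, F S -> ext F (ralg_mod S).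
Hypothesis evK : forall S, cancel (@ext_eval R F S) (@evI S).
Hypothesis evIK : forall S, cancel (@evI S) (@ext_eval R F S).
Variable psi : modFunHom (ext F) (ext F').

Definition restr_fun S (f : F S) : F' S :=
  ext_eval (psi (ralg_mod S) (evI f)).

Lemma restr_fun_eval S (f : ext F (ralg_mod S)) :
  restr_fun (ext_eval f) = ext_eval (psi (ralg_mod S) f).
Proof. by rewrite /restr_fun evK. Qed.

Lemma restr_fun_zmod S : zmod_morphism (@restr_fun S).
Proof.
move=> f g; rewrite -[f]evIK -[g]evIK -raddfB !restr_fun_eval.
by rewrite !raddfB.
Qed.
HB.instance Definition _ S :=
  GRing.isZmodMorphism.Build (F S) (F' S) (@restr_fun S) (@restr_fun_zmod S).

(** Write the action of s on F(S) as an effect of the R-linear map t |-> t s;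
    the naturality of [psi] along this map is then the S-linearity. *)
Lemma restr_fun_scalable S : scalable (@restr_fun S).
Proof.
move=> s f; rewrite -[f]evIK -[X in restr_fun X]ext_eval_act !restr_fun_eval.
by rewrite mfunh_nat ext_eval_act.
Qed.
HB.instance Definition _ S :=
  GRing.isScalable.Build (S : pzRingType)^c (F S) (F' S) *:%R (@restr_fun S)
    (@restr_fun_scalable S).

Lemma restr_fun_nat S T (h : rAlgHom S T) (f : F S) :
  restr_fun (rmod_map F h f) = rmod_map F' h (restr_fun f).
Proof.
rewrite -[f]evIK -ext_eval_nat !restr_fun_eval.
by rewrite mfunh_nat ext_eval_nat.
Qed.

Definition restr : rightModHom F F' :=
  @RightModHom R F F' (fun S => @restr_fun S) restr_fun_nat.

Lemma ext_hom_restr : ext_hom restr = psi.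
Proof.
apply: modFunHom_ext => M f; apply: val_inj.
transitivity (restr_fun (ext_val f)); first by [].
by rewrite -ext_eval_incl restr_fun_eval mfunh_nat ext_eval_incl.
Qed.

Lemma restr_ext_hom (phi : rightModHom F F') : ext_hom phi = psi -> restr = phi.
Proof.
move=> ephi; apply: rightModHom_ext => S f.
transitivity (restr_fun f); first by [].
by rewrite -[f]evIK restr_fun_eval ext_eval_hom ephi.
Qed.

End Restriction.

Lemma ext_hom_bij F F' :
  (forall S, bijective (@ext_eval R F S)) -> bijective (@ext_hom R F F').
Proof.
move=> evB.
have inv S : {g | cancel (@ext_eval R F S) g & cancel g (@ext_eval R F S)}.
  by apply: cid2; case: (evB S) => g evK evIK; exists g.
exists (restr (fun S => s2valP (inv S)) (fun S => s2valP' (inv S))) => [phi|psi]; first exact: restr_ext_hom.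
exact: ext_hom_restr.
Qed.

End Evaluation.

Theorem theorem4p8 (R : pzRingType) (F : rightMod R)
    (HF : forall S : rAlg R, bijective (@ext_eval R F S))
    (F' : rightMod R) :
  [/\ bijective (@ext_hom R F F'),
      (forall phi psi : rightModHom F F',
         ext_hom (rmodh_add phi psi) = mfunh_add (ext_hom phi) (ext_hom psi)),
      (forall (F'' : rightMod R) (psi : rightModHom F' F'')
              (phi : rightModHom F F'),
         ext_hom (rmodh_comp psi phi) = mfunh_comp (ext_hom psi) (ext_hom phi))
    & (forall (F0 : rightMod R) (chi : rightModHom F0 F)
              (phi : rightModHom F F'),
         ext_hom (rmodh_comp phi chi) = mfunh_comp (ext_hom phi) (ext_hom chi))].
Proof.
split; first exact: ext_hom_bij.
- by move=> phi psi; apply: modFunHom_ext => M f; exact: val_inj.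
- by move=> F'' psi phi; apply: modFunHom_ext => M f; exact: val_inj.
- by move=> F0 chi phi; apply: modFunHom_ext => M f; exact: val_inj.
Qed.
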